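(* Let $g_2,g_3$ be algebraically independent parameters. The Weierstrass sigma-function satisfies $$\sigma(u;g_2,g_3)\in\mathcal H_{\mathbb Z[g_2/2,\,6g_3]}[[u]],$$ and $\mathbb Z[g_2/2,6g_3]$ is its minimal Hurwitz coefficient ring among subrings of $\mathbb Q[g_2,g_3]$: every subring $R\subseteq\mathbb Q[g_2,g_3]$ with $\sigma(u;g_2,g_3)\in\mathcal H_R[[u]]$ contains $\mathbb Z[g_2/2,6g_3]$.
   Context: For a torsion-free commutative ring $R$, the set of Hurwitz series over $R$ is $$\mathcal H_R[[u]]=\left\{\sum_{n\ge0}c_n\frac{u^n}{n!}\in(R\otimes_{\mathbb Z}\mathbb Q)[[u]]\ \Big|\ c_n\in R\right\}.$$ $\sigma(u;g_2,g_3)=u+O(u^5)\in\mathbb Q[g_2,g_3][[u]]$ is the (odd) Weierstrass sigma-function as a formal power series: $-(\log\sigma)''=\wp$, where $\wp=\wp(u;g_2,g_3)=u^{-2}+O(u^2)$ satisfies $(\wp')^2=4\wp^3-g_2\wp-g_3$. *)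

(* Defs.v *)
From mathcomp Require Import all_boot all_order all_algebra.
From mathcomp Require Import zify ring.
From mathcomp Require Export mpoly.

Set Implicit Arguments.
Unset Strict Implicit.
Unset Printing Implicit Defensive.

Import Order.TTheory GRing.Theory Num.Theory.
Local Open Scope ring_scope.

Section Series.
Variable A : comNzRingType.

(* A formal power series over A is its coefficient sequence nat -> A.
   Laurent p c stands for the Laurent series u^(-p) * \sum_n c n * u^n; several
   pairs (p, c) stand for the same series, so Laurent series are only ever
   compared through their coefficients lcoef. *)
Record laurent := Laurent { pole : nat; coefs : nat -> A }.

Definition lcoef (f : laurent) (k : int) : A :=
  if k + (pole f)%:Z is Posz n then coefs f n else 0.

Definition lmul (f g : laurent) : laurent :=
  Laurent (pole f + pole g)
    (fun n => \sum_(i < n.+1) coefs f i * coefs g (n - i)%N).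

Definition lderiv (f : laurent) : laurent :=
  Laurent (pole f).+1 (fun n => (n%:Z - (pole f)%:Z)%:~R * coefs f n).

Definition lpowser (s : nat -> A) : laurent := Laurent 0 s.

(* wp = u^-2 + O(u^2) and wp'^2 = 4 wp^3 - g2 wp - g3 *)
Definition is_weierstrass_p (g2 g3 : A) (wp : laurent) : Prop :=
  [/\ lcoef wp (- 2%:Z) = 1,
      forall k : int, k < 2 -> k != - 2%:Z -> lcoef wp k = 0
    & forall k : int,
        lcoef (lmul (lderiv wp) (lderiv wp)) k
        = 4%:R * lcoef (lmul wp (lmul wp wp)) k
          - g2 * lcoef wp k - (if k == 0 then g3 else 0)].

(* sigma = u + O(u^5) is odd and - (log sigma)'' = wp; the logarithmic
   derivative of sigma is the Laurent series zeta with zeta * sigma = sigma'. *)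
Definition is_weierstrass_sigma (g2 g3 : A) (sigma : nat -> A) : Prop :=
  [/\ forall n : nat, (n < 5)%N -> sigma n = (n == 1%N)%:R,
      forall n : nat, ~~ odd n -> sigma n = 0
    & exists wp zeta : laurent,
      [/\ is_weierstrass_p g2 g3 wp,
          forall k : int, lcoef (lmul zeta (lpowser sigma)) k
                          = lcoef (lderiv (lpowser sigma)) k
        & forall k : int, - lcoef (lderiv zeta) k = lcoef wp k]].

Definition is_subring (R : A -> Prop) : Prop :=
  [/\ R 1, forall x y, R x -> R y -> R (x - y)
    & forall x y, R x -> R y -> R (x * y)].

(* x \in Z[a, b] *)
Definition in_Zadjoin2 (a b : A) (x : A) : Prop :=
  exists P : {mpoly int[2]},
    x = mmap intr (fun i : 'I_2 => if i == ord0 then a else b) P.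

End Series.

(* R is (the predicate of) a subring of the Q-algebra A, so R (x) Q embeds in
   A and a Hurwitz series over R is a power series over A. *)
Definition is_hurwitz (A : comAlgType rat) (R : A -> Prop) (f : nat -> A) : Prop :=
  exists c : nat -> A,
    (forall n, R (c n)) /\ forall n, f n = (n`!%:R^-1 : rat) *: c n.

Definition g2 : {mpoly rat[2]} := 'X_ord0.
Definition g3 : {mpoly rat[2]} := 'X_ord_max.

(* The coefficients of wp are built by the recursion from
   wp'' = 6 wp^2 - g2 / 2, those of sigma from zeta * sigma = sigma'. *)
Module SigmaExistence.

Lemma course_of_values (A : Type) (a0 : A) (G : nat -> (nat -> A) -> A) :
  (forall n f g, (forall i, (i < n)%N -> f i = g i) -> G n f = G n g) ->
  exists f : nat -> A, forall n, f n = G n f.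
Proof.
move=> HG.
pose F (m : nat) (f : nat -> A) : nat -> A := fun k => G k f.
pose H m := iter m (F 0%N) (fun _ => a0).
have HH k : forall n m, (k < n)%N -> (k < m)%N -> H n k = H m k.
  elim/ltn_ind: k => k IH [|n] [|m] //= kn km.
  by apply: HG => i ik; apply: IH => //; lia.
exists (fun n => H n.+1 n) => n /=; apply: HG => i iln.
exact: (HH i n i.+1 iln (ltnSn i)).
Qed.

Section Ex.
Variable A : comAlgType rat.
Variables a b : A.
Implicit Types f g h : nat -> A.

Definition cv f g n : A := \sum_(i < n.+1) f i * g (n - i)%N.

Definition dv (m : int) (x : A) := (m%:~R^-1 : rat) *: x.

Lemma dvK (m : int) x : m != 0 -> m%:~R * dv m x = x.
Proof.
move=> m0; rewrite /dv -scalerAr mulrzl -scaler_int scalerA. 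
by rewrite mulVf ?scale1r // intr_eq0.
Qed.

Lemma intI (m : int) (x y : A) : m != 0 -> m%:~R * x = m%:~R * y -> x = y.
Proof.
move=> m0 e; rewrite -[x](@dvK m) // -[y](@dvK m) //.
by rewrite /dv -!scalerAr e.
Qed.

Definition agree N f (p : {poly A}) := forall n, (n < N)%N -> p`_n = f n.

Lemma agree_poly N f : agree N f (\poly_(i < N) f i).
Proof. by move=> n nN; rewrite coef_poly nN. Qed.

Lemma agree_cv N f g p q : agree N f p -> agree N g q -> agree N (cv f g) (p * q).
Proof.
move=> Hp Hq n nN; rewrite coefM; apply: eq_bigr => -[i ilt] _ /=.
by rewrite Hp ?Hq //; lia.
Qed.

Lemma wp_ex : exists W : nat -> A,
  [/\ W 0%N = 1, forall n, odd n -> W n = 0, W 2%N = 0, W 6%N = dv 28 b &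
   forall n, ((n%:Z - 3) * (n%:Z - 2))%:~R * W n
      = 6%:R * cv W W n - (if n == 4%N then dv 2 a else 0)].
Proof.
pose G n (f : nat -> A) : A :=
  if n == 0%N then 1 else if n == 6%N then dv 28 b else
  dv ((n%:Z - 6) * (n%:Z + 1))
     (6%:R * (\sum_(i < n.-1) f i.+1 * f (n.-1 - i)%N) - (if n == 4%N then dv 2 a else 0)).
have [n f g fg|W HW] := @course_of_values A 0 G.
  rewrite /G; case: eqP => // n0; case: eqP => // n6.
  congr (dv _ (_ * _ - _)); apply: eq_bigr => i _.
  by case: i => i /= ilt; rewrite !fg //; lia.
have W0 : W 0%N = 1 by rewrite HW.
have W6 : W 6%N = dv 28 b by rewrite HW.
have dv0 m : dv m 0 = 0 by rewrite /dv scaler0.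
have Wodd n : odd n -> W n = 0.
  elim/ltn_ind: n => n IH on; rewrite HW /G.
  case: eqP => [n0|_]; first by rewrite n0 in on.
  case: eqP => [n0|_]; first by rewrite n0 in on.
  case: eqP => [n0|_]; first by rewrite n0 in on.
  rewrite big1 ?mulr0 ?subr0 ?dv0 // => -[i /= ilt] _.
  have [oi|oi] := boolP (odd i.+1); first by rewrite IH ?mul0r //; lia.
  by rewrite (IH (n.-1 - i)%N) ?mulr0 //; lia.
have W2 : W 2%N = 0.
  by rewrite HW /G /= big_ord1 (Wodd 1%N) // mul0r mulr0 subr0 dv0.
exists W; split=> // n; rewrite /cv.
have [->|n0] := eqVneq n 0%N.
  by rewrite big_ord1 W0 /= subr0 !mulr1.
have en : n = n.-1.+1 by lia.
have -> : \sum_(i < n.+1) W i * W (n - i)%N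
   = 2%:R * W n + \sum_(i < n.-1) W i.+1 * W (n.-1 - i)%N.
  case: n n0 {en} => // n _; rewrite big_ord_recl big_ord_recr /= subn0 W0 mul1r.
  have -> : (n.+1 - bump 0 n)%N = 0%N by rewrite /bump; lia.
  have -> : (bump 0 n)%N = n.+1 by rewrite /bump; lia.
  by rewrite W0 mulr1; set S1 := bigop _ _ _; ring.
set S := \sum_(i < _) _.
have E : ((n%:Z - 6) * (n%:Z + 1))%:~R * W n = 6%:R * S - (if n == 4%N then dv 2 a else 0).
  have [n6|n6] := eqVneq n 6%N.
    rewrite /S {}n6 /= !big_ord_recl big_ord0 /bump /= W2 !(Wodd 1%N, Wodd 3, Wodd 5) //.
    by rewrite !(mul0r, mulr0, addr0, subr0).
  by rewrite {1}HW /G (negbTE n0) (negbTE n6) dvK // mulf_neq0 //; lia.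
have -> : (n%:Z - 3) * (n%:Z - 2) = 12 + (n%:Z - 6) * (n%:Z + 1) by ring.
rewrite rmorphD /= mulrDl E; set T := if _ then _ else _; clearbody T S.
have -> : 12%:~R = 12%:R :> A by [].
by ring.
Qed.

Definition th (k : int) f : nat -> A := fun n => (n%:Z - k)%:~R * f n.

Definition pth (k : int) (p : {poly A}) : {poly A} := 'X * p^`() - (k%:~R : {poly A}) * p.

Lemma coef_pth k p n : (pth k p)`_n = (n%:Z - k)%:~R * p`_n.
Proof.
rewrite /pth coefB coefXM coef_deriv.
have -> : ((k%:~R : {poly A}) * p)`_n = k%:~R * p`_n.
  by rewrite !mulrzl coefMrz.
rewrite rmorphB /= mulrBl; congr (_ - _).
case: n => [|n] /=; first by rewrite mul0r.
by rewrite -mulr_natl.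
Qed.

Lemma agree_th N k f p : agree N f p -> agree N (th k f) (pth k p).
Proof. by move=> H n nN; rewrite coef_pth H. Qed.

Lemma cv6 f g : cv f g 6 = f 0%N * g 6 + (f 1%N * g 5 + (f 2 * g 4 + (f 3 * g 3
  + (f 4 * g 2 + (f 5 * g 1%N + f 6 * g 0%N))))).
Proof. by rewrite /cv !big_ord_recl big_ord0 addr0. Qed.

Lemma ode_ex (W : nat -> A) :
  [/\ W 0%N = 1, forall n, odd n -> W n = 0, W 2%N = 0, W 6%N = dv 28 b &
   forall n, ((n%:Z - 3) * (n%:Z - 2))%:~R * W n
      = 6%:R * cv W W n - (if n == 4%N then dv 2 a else 0)] ->
  forall n, cv (th 2 W) (th 2 W) n
    = 4%:R * cv W (cv W W) n - (if (3 < n)%N then a * W (n - 4)%N else 0)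
      - (if n == 6%N then b else 0).
Proof.
case=> W0 Wo W2 W6 HW n.
have [->|n6] := eqVneq n 6%N.
  have W1 := Wo 1%N isT; have W3 := Wo 3 isT; have W5 := Wo 5 isT.
  rewrite (cv6 (th 2 W)) (cv6 W) /cv /th !big_ord_recl !big_ord0 /= /bump /=.
  rewrite /subn /= !(W0, W1, W2, W3, W5).
  have := @dvK 28 b isT; rewrite -W6; move: (W 6%N) (W 4%N) => X Y <-.
  by rewrite !(mul0r, mulr0, mul1r, mulr1, addr0, add0r, subr0, sub0r); ring.
pose N := n.+1; pose w := \poly_(i < N) W i.
have aw : agree N W w by apply: agree_poly.
pose v := pth 2 w.
pose E := v * v - 4%:R * (w * (w * w)) + a%:P * ('X^4 * w) + b%:P * 'X^6.
pose F := 2%:R * pth 3 v - 12%:R * (w * w) + a%:P * 'X^4.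
have EF : pth 6 E = v * F.
  rewrite /F /E /pth !derivE /=.
rewrite /v /pth -!pmulrn; move: (w^`()) => D1; move: (D1^`()) => D2.
  by clearbody w; ring.
have F0 : forall m, (m < N)%N -> F`_m = 0.
  move=> m mN.
  rewrite /F coefD coefB coefCM coefXn -!polyC_natr !coefCM !coef_pth.
  rewrite (agree_cv aw aw) // aw //.
  have := HW m; rewrite rmorphM /= -mulrA => /(congr1 (fun x => 2%:R * x)) e.
  rewrite e.
  case: eqP => _ /=; last by ring.
  have := @dvK 2 a isT; move: (dv 2 a) => d; rewrite -pmulrn => <-; ring.
have E0 : E`_n = 0.
  apply: (@intI (n%:Z - 6)); first by apply/eqP; move/eqP: n6; lia.
  rewrite -coef_pth EF mulr0 coefM big1 // => -[i ilt] _ /=.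
  by rewrite F0 ?mulr0 // /N; lia.
move: E0; rewrite /E !coefD coefN -polyC_natr !coefCM coefXn coefXnM (negbTE n6) /= mulr0 addr0.
have av := agree_th 2 aw.
rewrite (agree_cv av av) // (agree_cv aw (agree_cv aw aw)) // subr0.
move=> e; apply: subr0_eq; rewrite -[RHS]e.
case: (ltnP n 4) => h; first by ring.
by rewrite aw; [ring | rewrite /N; lia].
Qed.

Lemma sigma_ex : exists s : nat -> A, is_weierstrass_sigma a b s.
Proof.
have [W HW] := wp_ex; have ode := ode_ex HW.
case: HW => W0 Wo W2 W6 HW.
have dv0 m : dv m 0 = 0 by rewrite /dv scaler0.
pose Z n : A := if n == 1%N then 0 else dv (1 - n%:Z) (W n).
have HZ n : (1 - n%:Z)%:~R * Z n = W n.
  rewrite /Z; case: eqP => [->|n1]; first by rewrite subrr mul0r Wo.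
  by rewrite dvK //; apply/eqP; lia.
have Zo n : odd n -> Z n = 0 by move=> on; rewrite /Z; case: ifP => // _; rewrite Wo ?dv0.
have Z0 : Z 0%N = 1 by rewrite -W0 -HZ mul1r.
have Z2 : Z 2%N = 0 by rewrite /Z /= W2 dv0.
pose G n (f : nat -> A) : A :=
  if n == 0%N then 0 else if n == 1%N then 1 else
  dv (n%:Z - 1) (\sum_(i < n) Z i.+1 * f (n.-1 - i)%N).
have [n f g fg|s Hs] := @course_of_values A 0 G.
  rewrite /G; case: eqP => // n0; case: eqP => // n6.
  congr (dv _ _); apply: eq_bigr => -[i /= ilt] _.
  by rewrite fg //; lia.
have s0 : s 0%N = 0 by rewrite Hs.
have s1 : s 1%N = 1 by rewrite Hs.
have so n : ~~ odd n -> s n = 0.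
  elim/ltn_ind: n => n IH en; rewrite Hs /G.
  case: eqP => [//|n0]; case: eqP => [n1|n1]; first by rewrite n1 in en.
  rewrite big1 ?dv0 // => -[i /= ilt] _.
  have [oi|oi] := boolP (odd i.+1); first by rewrite Zo ?mul0r.
  by rewrite IH ?mulr0 //; lia.
have s3 : s 3 = 0.
  rewrite Hs /G /= !big_ord_recl big_ord0 /bump /= Z2 (Zo 1%N) // (Zo 3) //.
  by rewrite !mul0r !addr0 dv0.
have Hlog n : cv Z s n = n%:R * s n.
  rewrite /cv big_ord_recl subn0 Z0 mul1r.
  have -> : \sum_(i < n) Z (lift ord0 i) * s (n - lift ord0 i)%N
     = \sum_(i < n) Z i.+1 * s (n.-1 - i)%N.
    by apply: eq_bigr => -[i ilt] _; congr (_ * s _); rewrite /= /bump; lia.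
  have [->|n0] := eqVneq n 0%N; first by rewrite big_ord0 s0 addr0 mulr0.
  have [->|n1] := eqVneq n 1%N.
    by rewrite big_ord1 (Zo 1%N) // mul0r addr0 mul1r.
  set S := \sum_(i < _) _.
  have : (n%:Z - 1)%:~R * s n = S.
    by rewrite Hs /G (negbTE n0) (negbTE n1) dvK //; apply/eqP; lia.
  by move=> <-; rewrite rmorphB /= mulrBl mul1r addrC subrK.
exists s; split => //.
  by case=> [|[|[|[|[|]]]]] // _; rewrite ?s0 ?s1 ?s3 // so.
exists (Laurent 2 W), (Laurent 1 Z); split.
- split.
  + by rewrite /lcoef /=.
  + move=> k k2 kn; rewrite /lcoef /=.
    case e: (k + 2%:Z) => [m|//].
    have : (m < 4)%N by lia.
    have : m != 0%N by apply/eqP => m0; move: kn; rewrite m0 in e; lia.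
    by case: m {e} => [|[|[|[|]]]] // _ _; rewrite ?W2 // Wo.
  + move=> k; rewrite /lcoef /= !addnS !addn0 /=.
    case e: (k + 6%:Z) => [m|m].
      have := ode m; rewrite /cv /th => ->.
      have -> : (k == 0) = (m == 6%N) by lia.
      congr (_ - _ - _).
      case e2: (k + 2%:Z) => [m2|m2].
        have -> : (3 < m)%N by lia.
        by congr (_ * W _); lia.
      by rewrite ifF ?mulr0 //; lia.
    have -> : (k == 0) = false by lia.
    case e2: (k + 2%:Z) => [m2|m2]; first lia.
    by rewrite !mulr0 !subr0.
- move=> k; rewrite /lcoef /=.
  case e: (k + 1%:Z) => [m|//].
  by have := Hlog m; rewrite /cv => ->; rewrite subr0.
- move=> k; rewrite /lcoef /=.
  case e: (k + 2%:Z) => [m|m]; last by rewrite oppr0.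
  by rewrite -HZ -mulNr -rmorphN /= opprB.
Qed.
End Ex.

End SigmaExistence.

Lemma weierstrass_sigma_exists :
  exists sigma : nat -> {mpoly rat[2]}, is_weierstrass_sigma g2 g3 sigma.
Proof. exact: SigmaExistence.sigma_ex. Qed.

(* Main.v *)
(** Write x = g2/2, y = 6 g3 and S_n for the coefficient of u^n/n! in sigma.
    The ratios sigma^(k)/sigma are polynomials in zeta, wp, wp' and x, so the
    differential equation of wp gives two bilinear equations for sigma, the
    first of which is
      sigma sigma^(4) - 4 sigma' sigma^(3) + 3 (sigma^(2))^2 = x sigma^2.
    With the derivation D = y d/dx + 16 x^2 d/dy, they imply that
    h = 6 (sigma^(2) - D sigma) + x u^2 sigma satisfies the linearisation of the
    first one; the initial coefficients of h vanish, so h = 0 (Weierstrass' heat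
    equation), that is
      S_(k+2) = D S_k - k (k-1)/6 x S_(k-2).
    A denominator, namely 3, can only appear for k = 2 mod 3; but then 3 | k-2,
    and the first bilinear equation modulo 3 forces 3 | S_n whenever 3 | n.
    Minimality holds because S_5 = -x and S_7 = -y. *)
Require Import Defs.
From HB Require Import structures.
From mathcomp Require Import all_boot all_order all_algebra.
From mathcomp Require Import zify ring.
From mathcomp Require boolp.

Set Implicit Arguments.
Unset Strict Implicit.

Import GRing.Theory.
Local Open Scope ring_scope.

(** * The ring of formal power series over a Q-algebra, with its derivations *)

Lemma leibniz1 (A : pzRingType) (D : A -> A) :
  (forall x y, D (x * y) = D x * y + x * D y) -> D 1 = 0.
Proof.
by move/(_ 1 1)/eqP; rewrite !mul1r mulr1 addrC -subr_eq subrr => /eqP <-.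
Qed.

(** A separate name for sequences, so that their ring structure is the one given by convolution. *)
Definition fps (A : comAlgType rat) : Type := nat -> A.

Section FormalPowerSeries.
Variable A : comAlgType rat.
Implicit Types (f g h : fps A) (c : A).

HB.instance Definition _ := boolp.gen_eqMixin (fps A).
HB.instance Definition _ := boolp.gen_choiceMixin (fps A).

Lemma fpsP f g : (forall n, f n = g n) -> f = g.
Proof. exact: boolp.funext. Qed.

Definition fps_zero : fps A := fun=> 0.
Definition fps_opp f : fps A := fun n => - f n.
Definition fps_add f g : fps A := fun n => f n + g n.

Fact fps_addA : associative fps_add.
Proof. by move=> f g h; apply: fpsP => n; apply: addrA. Qed.
Fact fps_addC : commutative fps_add.
Proof. by move=> f g; apply: fpsP => n; apply: addrC. Qed.
Fact fps_add0 : left_id fps_zero fps_add.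
Proof. by move=> f; apply: fpsP => n; apply: add0r. Qed.
Fact fps_addN : left_inverse fps_zero fps_opp fps_add.
Proof. by move=> f; apply: fpsP => n; apply: addNr. Qed.

HB.instance Definition _ :=
  GRing.isZmodule.Build (fps A) fps_addA fps_addC fps_add0 fps_addN.

Definition fps_const c : fps A := fun n => if n == 0%N then c else 0.
Definition fps_mul f g : fps A := SigmaExistence.cv f g.

Fact fps_mulC : commutative fps_mul.
Proof.
move=> f g; apply: fpsP => n.
have af := @SigmaExistence.agree_poly A n.+1 f.
have ag := @SigmaExistence.agree_poly A n.+1 g.
rewrite /fps_mul -(SigmaExistence.agree_cv af ag) //.
by rewrite -(SigmaExistence.agree_cv ag af) // mulrC.
Qed.

Fact fps_mulA : associative fps_mul.
Proof.
move=> f g h; apply: fpsP => n.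
have af := @SigmaExistence.agree_poly A n.+1 f.
have ag := @SigmaExistence.agree_poly A n.+1 g.
have ah := @SigmaExistence.agree_poly A n.+1 h.
rewrite /fps_mul.
rewrite -(SigmaExistence.agree_cv af (SigmaExistence.agree_cv ag ah)) //.
by rewrite -(SigmaExistence.agree_cv (SigmaExistence.agree_cv af ag) ah) // mulrA.
Qed.

Lemma fps_mul_const c f n : fps_mul (fps_const c) f n = c * f n.
Proof.
rewrite /fps_mul /SigmaExistence.cv big_ord_recl subn0 /= big1 ?addr0 // => i _.
by rewrite mul0r.
Qed.

Fact fps_mul1 : left_id (fps_const 1) fps_mul.
Proof. by move=> f; apply: fpsP => n; rewrite fps_mul_const mul1r. Qed.

Fact fps_mulDl : left_distributive fps_mul +%R.
Proof.
move=> f g h; apply: fpsP => n; rewrite /fps_mul /SigmaExistence.cv.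
transitivity (\sum_(i < n.+1) (f i * h (n - i)%N + g i * h (n - i)%N)).
  by apply: eq_bigr => i _; rewrite -mulrDl.
by rewrite big_split.
Qed.

Fact fps_1_neq0 : fps_const 1 != 0.
Proof. by apply/eqP => /(congr1 (fun f : fps A => f 0%N)) /eqP; rewrite oner_eq0. Qed.

HB.instance Definition _ := GRing.Zmodule_isComNzRing.Build (fps A)
  fps_mulA fps_mulC fps_mul1 fps_mulDl fps_1_neq0.

Lemma fcoefD f g n : (f + g) n = f n + g n. Proof. by []. Qed.
Lemma fcoefN f n : (- f) n = - f n. Proof. by []. Qed.
Lemma fcoefM f g n : (f * g) n = \sum_(i < n.+1) f i * g (n - i)%N. Proof. by []. Qed.
Lemma fcoefC c f n : (fps_const c * f) n = c * f n.
Proof. exact: fps_mul_const. Qed.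

Lemma fcoefMn f k n : (f *+ k) n = f n *+ k.
Proof. by elim: k => [|k IH] //; rewrite !mulrS fcoefD IH. Qed.

Lemma fcoefMnat f k n : (k%:R * f) n = k%:R * f n.
Proof. by rewrite !mulr_natl fcoefMn. Qed.

Definition fpsX : fps A := fun n => (n == 1%N)%:R.

Lemma fcoefXM f n : (fpsX * f) n = if n is m.+1 then f m else 0.
Proof.
rewrite fcoefM big_ord_recl mul0r add0r.
case: n => [|n]; first by rewrite big_ord0.
rewrite big_ord_recl mul1r subSS subn0 big1 ?addr0 // => i _.
by rewrite mul0r.
Qed.

Lemma fcoefXnM k f n : (fpsX ^+ k * f) n = if (k <= n)%N then f (n - k)%N else 0.
Proof.
elim: k n => [|k IH] n; first by rewrite expr0 mul1r subn0.
by rewrite exprS -mulrA fcoefXM; case: n => // n; rewrite IH.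
Qed.

Lemma fcoefM_lead f g N : (forall i, (i < N)%N -> f i = 0) ->
  (f * g) N = f N * g 0%N.
Proof.
move=> f0; rewrite fcoefM big_ord_recr /= subnn big1 ?add0r // => i _.
by rewrite f0 ?mul0r.
Qed.

(** Cancelling powers of u replaces negative exponents: identities are proved after multiplication
    by a suitable power of u. *)
Lemma fpsX_lreg : GRing.lreg fpsX.
Proof.
apply: mulrI0_lreg => g Xg; apply: fpsP => n.
by have /(congr1 (fun f : fps A => f n.+1)) := Xg; rewrite fcoefXM.
Qed.

(** In a product f g = 0, the lowest nonzero coefficient of g would be killed by the constant term
    of f. *)
Lemma lreg_coef0 f : GRing.lreg (f 0%N) -> GRing.lreg f.
Proof.
move=> f0; apply: mulrI0_lreg => g fg; apply: fpsP.
elim/ltn_ind => n IH; apply: f0; rewrite mulr0.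
by rewrite mulrC -(fcoefM_lead f IH) mulrC fg.
Qed.

Lemma natr_lreg n : (0 < n)%N -> GRing.lreg (n%:R : A).
Proof. by move=> n0 y z /(@SigmaExistence.intI A n); apply; apply/eqP; lia. Qed.

Lemma natr_fps_lreg n : (0 < n)%N -> GRing.lreg (n%:R : fps A).
Proof.
move=> n0; apply: lreg_coef0; rewrite fcoefMn -mulr_natl mulr1.
exact: natr_lreg.
Qed.

Definition fderiv f : fps A := fun n => n.+1%:R * f n.+1.

Lemma fcoef_Xderiv f n : (fpsX * fderiv f) n = n%:R * f n.
Proof. by rewrite fcoefXM; case: n => [|n] //; rewrite mul0r. Qed.

Lemma fderivD f g : fderiv (f + g) = fderiv f + fderiv g.
Proof. by apply: fpsP => n; rewrite fcoefD /fderiv -mulrDr. Qed.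

Lemma fderivN f : fderiv (- f) = - fderiv f.
Proof. by apply: fpsP => n; rewrite fcoefN /fderiv -mulrN. Qed.

(** Multiplied by u, the derivation becomes the Euler operator, which multiplies the n-th
    coefficient by n; writing n = i + (n - i) in each term of the convolution gives the Leibniz
    rule. *)
Lemma fderivM f g : fderiv (f * g) = fderiv f * g + f * fderiv g.
Proof.
apply: fpsX_lreg; rewrite mulrDr mulrA (mulrCA fpsX f); apply: fpsP => n.
rewrite fcoef_Xderiv fcoefD !fcoefM mulr_sumr -big_split /=.
apply: eq_bigr => -[i ilt] _ /=; rewrite !fcoef_Xderiv natrB //.
by ring.
Qed.

Lemma fderivC c : fderiv (fps_const c) = 0.
Proof. by apply: fpsP => n; rewrite /fderiv mulr0. Qed.

Lemma fderiv0 : fderiv 0 = 0.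
Proof. by apply: fpsP => n; rewrite /fderiv mulr0. Qed.

Lemma fderiv1 : fderiv 1 = 0.
Proof. exact: fderivC. Qed.

Lemma fderiv_nat k : fderiv k%:R = 0.
Proof.
elim: k => [|k IH]; first exact: fderiv0.
by rewrite mulrS fderivD IH fderiv1 addr0.
Qed.

Lemma fderiv_expS f n : fderiv (f ^+ n.+1) = n.+1%:R * f ^+ n * fderiv f.
Proof.
elim: n => [|n IH]; first by rewrite expr1 expr0; ring.
by rewrite exprS fderivM IH -[n.+2]addn1 natrD !exprS; ring.
Qed.

Lemma fderivX : fderiv fpsX = 1.
Proof. by apply: fpsP => -[|n]; rewrite /fderiv ?mulr1 //= mulr0. Qed.

Section CoefficientwiseDerivation.
Variable D : {additive A -> A}.
Hypothesis DM : forall x y, D (x * y) = D x * y + x * D y.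

Definition fps_map f : fps A := fun n => D (f n).

Lemma fps_mapD f g : fps_map (f + g) = fps_map f + fps_map g.
Proof. by apply: fpsP => n; rewrite fcoefD /fps_map -raddfD. Qed.

Lemma fps_mapN f : fps_map (- f) = - fps_map f.
Proof. by apply: fpsP => n; rewrite fcoefN /fps_map -raddfN. Qed.

Lemma fps_mapM f g : fps_map (f * g) = fps_map f * g + f * fps_map g.
Proof.
apply: fpsP => n; rewrite fcoefD !fcoefM -big_split /= /fps_map fcoefM raddf_sum.
by apply: eq_bigr => i _; rewrite DM.
Qed.

Lemma fps_mapC c : fps_map (fps_const c) = fps_const (D c).
Proof. by apply: fpsP => -[|n]; rewrite /fps_map //= raddf0. Qed.

Lemma fps_map0 : fps_map 0 = 0.
Proof. by apply: fpsP => n; rewrite /fps_map raddf0. Qed.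

Lemma fps_map_nat k : fps_map k%:R = 0.
Proof.
have d1 : fps_map 1 = 0.
  by apply: fpsP => -[|n]; rewrite /fps_map /= ?raddf0 // (leibniz1 DM).
elim: k => [|k IH]; first exact: fps_map0.
by rewrite mulrS fps_mapD IH d1 addr0.
Qed.

Lemma fps_map_deriv f : fps_map (fderiv f) = fderiv (fps_map f).
Proof. by apply: fpsP => n; rewrite /fps_map /fderiv !mulr_natl raddfMn. Qed.
End CoefficientwiseDerivation.
End FormalPowerSeries.

(** * The two bilinear differential equations of sigma *)

(* Z, W and V stand for u zeta, u^2 wp and u^3 wp', so that no negative powers
   occur; x is g2/2 and b is g3. *)
Section SigmaIdentities.
Variable A : comAlgType rat.
Variables (x b : A) (s Z W V : fps A).
Local Notation X := (fpsX A).
Local Notation "c %:S" := (fps_const c) (at level 1, format "c %:S").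
Local Notation d := (@fderiv A).

Hypothesis ds : X * d s = Z * s.
Hypothesis dZ : X * d Z = Z - W.
Hypothesis dW : X * d W = V + 2%:R * W.
Hypothesis V0 : V 0%N = - 2%:R.
Hypothesis V2 : V ^+ 2 = 4%:R * W ^+ 3 - 2%:R * x%:S * X ^+ 4 * W - b%:S * X ^+ 6.

(** This is wp'' = 6 wp^2 - x. Apply u d/du to [V2] and cancel 2 V, which is regular because its
    constant term is a nonzero integer. *)
Lemma dV : X * d V = 3%:R * V + 6%:R * W ^+ 2 - x%:S * X ^+ 4.
Proof.
have Vreg : GRing.lreg V.
  by apply: lreg_coef0; rewrite V0; apply/lregN/natr_lreg.
apply: Vreg; have := congr1 (fun f => X * d f) V2.
rewrite !(fderivD, fderivN, fderivM, fderivC, fderiv_nat, fderiv_expS) fderivX.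
move=> e.
have two : GRing.lreg (2%:R : fps A) by apply: natr_fps_lreg.
apply: two.
transitivity (X * (2%:R * V ^+ 1 * d V)); first by ring.
rewrite e.
transitivity (12%:R * W ^+ 2 * (X * d W)
   - 2%:R * x%:S * X ^+ 4 * (X * d W + 4%:R * W) - 6%:R * b%:S * X ^+ 6);
  first by ring.
rewrite dW.
transitivity (12%:R * W ^+ 2 * V + 24%:R * W ^+ 3 - 2%:R * x%:S * X ^+ 4 * V
   - 12%:R * x%:S * X ^+ 4 * W - 6%:R * b%:S * X ^+ 6); first by ring.
transitivity (6%:R * V ^+ 2 + 12%:R * W ^+ 2 * V - 2%:R * x%:S * X ^+ 4 * V); last by ring.
by rewrite V2; ring.
Qed.

(** Since sigma' = zeta sigma, differentiating P sigma gives (P' + P zeta) sigma; the term - k P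
    compensates for the derivative of u^k. *)
Lemma mulXn_deriv k f P Q : X ^+ k * f = P * s -> X * d P = Q ->
  X ^+ k.+1 * d f = (Q + P * Z - k%:R * P) * s.
Proof.
move=> e eP; have /(congr1 (fun f => X * d f)) := e.
rewrite !fderivM mulrDr [in RHS]mulrDr !mulrA eP -mulrA.
rewrite [X * P]mulrC -[P * X * _]mulrA ds => e2.
have -> : X ^+ k.+1 * d f = X * d (X ^+ k) * f + X * X ^+ k * d f - k%:R * (X ^+ k * f).
  case: k e e2 => [|k] _ _; first by rewrite expr0 fderiv1; ring.
  by rewrite fderiv_expS fderivX !exprS; ring.
by rewrite -[X * _ * f]mulrA e2 e; ring.
Qed.

Let dsum := (fderivD, fderivN, fderivM, fderivC, fderiv_nat, fderiv_expS).

(** From here to [s5]: the ratios u^k sigma^(k) / sigma for k = 1, ..., 5, each obtained from the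
    preceding one by [mulXn_deriv]. *)
Let s1 : X ^+ 1 * d s = Z * s. Proof. by rewrite expr1. Qed.

Let s2 : X ^+ 2 * d (d s) = (Z ^+ 2 - W) * s.
Proof. by rewrite (mulXn_deriv s1 dZ); ring. Qed.

Let s3 : X ^+ 3 * d (d (d s)) = (Z ^+ 3 - 3%:R * Z * W - V) * s.
Proof.
have e : X * d (Z ^+ 2 - W) = 2%:R * Z * (Z - W) - (V + 2%:R * W).
  by rewrite !dsum -dZ -dW; ring.
by rewrite (mulXn_deriv s2 e); ring.
Qed.

Let s4 : X ^+ 4 * d (d (d (d s)))
  = (Z ^+ 4 - 6%:R * Z ^+ 2 * W - 4%:R * Z * V - 3%:R * W ^+ 2 + x%:S * X ^+ 4) * s.
Proof.
have e : X * d (Z ^+ 3 - 3%:R * Z * W - V) =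
  3%:R * Z ^+ 2 * (Z - W) - 3%:R * (Z - W) * W - 3%:R * Z * (V + 2%:R * W)
  - (3%:R * V + 6%:R * W ^+ 2 - x%:S * X ^+ 4).
  by rewrite !dsum -dZ -dW -dV; ring.
by rewrite (mulXn_deriv s3 e); ring.
Qed.

Let s5 : X ^+ 5 * d (d (d (d (d s))))
  = (Z ^+ 5 - 10%:R * Z ^+ 3 * W - 10%:R * Z ^+ 2 * V - 15%:R * Z * W ^+ 2
     + 5%:R * x%:S * X ^+ 4 * Z - 2%:R * W * V) * s.
Proof.
have e : X * d (Z ^+ 4 - 6%:R * Z ^+ 2 * W - 4%:R * Z * V - 3%:R * W ^+ 2 + x%:S * X ^+ 4) =
  4%:R * Z ^+ 3 * (Z - W) - 12%:R * Z * (Z - W) * W - 6%:R * Z ^+ 2 * (V + 2%:R * W)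
  - 4%:R * (Z - W) * V - 4%:R * Z * (3%:R * V + 6%:R * W ^+ 2 - x%:S * X ^+ 4)
  - 6%:R * W * (V + 2%:R * W) + 4%:R * x%:S * X ^+ 4.
  rewrite -dV -dW -dZ !dsum fderivX; ring.
by rewrite (mulXn_deriv s4 e); ring.
Qed.

(** The Hirota form of wp'' = 6 wp^2 - x. Once multiplied by u^4, every derivative is a polynomial
    times sigma and everything cancels. *)
Lemma sigma_bilinear1 :
  s * d (d (d (d s))) - 4%:R * d s * d (d (d s)) + 3%:R * d (d s) ^+ 2
  - x%:S * s ^+ 2 = 0.
Proof.
apply: (lregX (n := 4) (@fpsX_lreg A)); rewrite mulr0.
transitivity (s * (X ^+ 4 * d (d (d (d s))))
  - 4%:R * (X ^+ 1 * d s) * (X ^+ 3 * d (d (d s)))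
  + 3%:R * (X ^+ 2 * d (d s)) ^+ 2 - x%:S * X ^+ 4 * s ^+ 2); first by ring.
by rewrite s1 s2 s3 s4; ring.
Qed.

Lemma sigma_bilinear2 :
  d s * d (d (d (d (d s)))) - 4%:R * d (d s) * d (d (d (d s)))
  + 3%:R * d (d (d s)) ^+ 2 + x%:S * (d s) ^+ 2
  - 2%:R * x%:S * s * d (d s) + 3%:R * b%:S * s ^+ 2 = 0.
Proof.
apply: (lregX (n := 6) (@fpsX_lreg A)); rewrite mulr0.
transitivity ((X ^+ 1 * d s) * (X ^+ 5 * d (d (d (d (d s)))))
  - 4%:R * (X ^+ 2 * d (d s)) * (X ^+ 4 * d (d (d (d s))))
  + 3%:R * (X ^+ 3 * d (d (d s))) ^+ 2 + x%:S * X ^+ 4 * (X ^+ 1 * d s) ^+ 2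
  - 2%:R * x%:S * X ^+ 4 * s * (X ^+ 2 * d (d s)) + 3%:R * b%:S * X ^+ 6 * s ^+ 2);
  first by ring.
rewrite s1 s2 s3 s4 s5.
(* What remains is 3 sigma^2 times the first-order equation wp'^2 = 4 wp^3 - g2 wp - g3, which
   brings in g3. *)
set l := LHS; have -> : l = 3%:R * s ^+ 2 * (V ^+ 2 - (4%:R * W ^+ 3
   - 2%:R * x%:S * X ^+ 4 * W - b%:S * X ^+ 6)) by rewrite /l; ring.
by rewrite V2 subrr mulr0.
Qed.
End SigmaIdentities.

(** * Coefficients of u^n/n! and the operators u^k (d/du)^k *)

Section ExponentialCoefficients.
Variable A : comAlgType rat.
Implicit Types f g : fps A.

(** The n-th Hurwitz coefficient of f. *)
Definition ecoef f n : A := n`!%:R * f n.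

Lemma ecoef_deriv f n : ecoef (fderiv f) n = ecoef f n.+1.
Proof. by rewrite /ecoef /fderiv factS natrM; ring. Qed.

Lemma ecoefD f g n : ecoef (f + g) n = ecoef f n + ecoef g n.
Proof. exact: mulrDr. Qed.

Lemma ecoefN f n : ecoef (- f) n = - ecoef f n.
Proof. exact: mulrN. Qed.

Lemma ecoefCM c f n : ecoef (fps_const c * f) n = c * ecoef f n.
Proof. by rewrite /ecoef fcoefC mulrCA. Qed.

Lemma ecoefMnat k f n : ecoef (k%:R * f) n = k%:R * ecoef f n.
Proof. by rewrite /ecoef fcoefMnat mulrCA. Qed.

Lemma ecoef_shift2 f n :
  n`!%:R * ((n.+1 * n.+2)%:R * f n.+2) = ecoef f n.+2.
Proof. by rewrite /ecoef mulrA -natrM !factS mulnCA mulnA; congr (_%:R * _); lia. Qed.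

Lemma fact2_fcoef f n : n.+2`!%:R * f n = (n.+2 * n.+1)%:R * ecoef f n.
Proof. by rewrite /ecoef mulrA -natrM !factS; congr (_%:R * _); lia. Qed.

Lemma ecoefM f g n :
  ecoef (f * g) n = \sum_(i < n.+1) 'C(n, i)%:R * (ecoef f i * ecoef g (n - i)%N).
Proof.
rewrite /ecoef fcoefM mulr_sumr; apply: eq_bigr => -[i ilt] _ /=.
by rewrite -(@bin_fact n i) // !natrM; ring.
Qed.

Lemma fcoef_Xn_derivn k f n :
  (fpsX A ^+ k * iter k (@fderiv A) f) n = (n ^_ k)%:R * f n.
Proof.
elim: k n => [|k IH] n; first by rewrite expr0 !mul1r.
(* With E = u d/du, one has u^(k+1) d^(k+1) = (E - k) u^k d^k, and E - k multiplies the n-th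
   coefficient by n - k. *)
have -> : fpsX A ^+ k.+1 * iter k.+1 (@fderiv A) f =
  fpsX A * fderiv (fpsX A ^+ k * iter k (@fderiv A) f)
  - k%:R * (fpsX A ^+ k * iter k (@fderiv A) f).
  case: k IH => [|k] _; first by rewrite expr1 expr0 !mul1r /=; ring.
  by rewrite fderivM fderiv_expS fderivX iterS !exprS; ring.
rewrite fcoefD fcoefN fcoefMnat fcoef_Xderiv IH ffactnSr natrM.
have [kn|nk] := leqP k n; first by rewrite natrB //; ring.
by rewrite ffact_small //; ring.
Qed.

Lemma fcoefM_lead1 f g N : (forall i, (i < N)%N -> f i = 0) -> g 0%N = 0 ->
  (f * g) N.+1 = f N * g 1%N.
Proof.
move=> f0 g0; rewrite fcoefM 2!big_ord_recr /= subnn subSnn g0 mulr0 addr0.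
by rewrite big1 ?add0r // => i _; rewrite f0 ?mul0r.
Qed.

End ExponentialCoefficients.

(** * The heat equation for sigma *)

Lemma ffact43 N : (2 < N)%N -> (N ^_ 4)%:Z - 4%:Z * (N ^_ 3)%:Z
  = N%:Z * (N%:Z - 1) * (N%:Z - 2%:Z) * (N%:Z - 7%:Z).
Proof. by case: N => [|[|[|N]]] // _; rewrite !ffactnS !ffactn0 /=; nia. Qed.

Section HeatEquation.
Variable A : comAlgType rat.
Variables (x b : A) (s : fps A).
Local Notation X := (fpsX A).
Local Notation "c %:S" := (fps_const c) (at level 1, format "c %:S").
Local Notation d := (@fderiv A).

(** The symmetric form with [bilin s s] equal to twice the left side of [bil1]; thus [bilin h s] is
    the derivative of that left side at s in the direction h. *)
Definition bilin f g : fps A :=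
  f * d (d (d (d g))) + d (d (d (d f))) * g
  - 4%:R * (d f * d (d (d g)) + d (d (d f)) * d g)
  + 6%:R * (d (d f) * d (d g)) - 2%:R * x%:S * (f * g).

Hypothesis s0 : s 0%N = 0.
Hypothesis s1 : s 1%N = 1.

(* The indicial polynomial at u^N is N(N-1)(N-2)(N-7). *)
Lemma bilin_kernel h : bilin h s = 0 ->
  h 0%N = 0 -> h 1%N = 0 -> h 2%N = 0 -> h 7%N = 0 -> h = 0.
Proof.
move=> hs h0 h1 h2 h7; apply: fpsP; elim/ltn_ind => N IH.
have [N0|N0] := boolP (N \in [:: 0; 1; 2; 7]%N).
  by move: N0; rewrite !inE => /or4P[] /eqP ->.
(* Multiplication by u^4 makes every operator diagonal on monomials. As h starts at u^N and s at u,
   the coefficient of u^(N+1) involves only h_N, and the x term has order at least N + 5. *)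
have e : X ^+ 0 * iter 0 d h * (X ^+ 4 * iter 4 d s)
  + X ^+ 4 * iter 4 d h * (X ^+ 0 * iter 0 d s)
  - 4%:R * (X ^+ 1 * iter 1 d h * (X ^+ 3 * iter 3 d s)
            + X ^+ 3 * iter 3 d h * (X ^+ 1 * iter 1 d s))
  + 6%:R * (X ^+ 2 * iter 2 d h * (X ^+ 2 * iter 2 d s))
  - x%:S * (h * (2%:R * X ^+ 4 * s)) = 0.
  have /(congr1 (fun f => X ^+ 4 * f)) := hs; rewrite mulr0 => <- /=.
  by rewrite /bilin; ring.
have IHk k i : (i < N)%N -> (X ^+ k * iter k d h) i = 0.
  by move=> iN; rewrite fcoef_Xn_derivn IH // mulr0.
have sk k : (X ^+ k * iter k d s) 0%N = 0 by rewrite fcoef_Xn_derivn s0 mulr0.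
have L k l : ((X ^+ k * iter k d h) * (X ^+ l * iter l d s)) N.+1
    = (N ^_ k)%:R * h N * (1 ^_ l)%:R.
  rewrite (fcoefM_lead1 (f := X ^+ k * iter k d h)) //; last exact: IHk.
  by rewrite !fcoef_Xn_derivn s1 mulr1.
have L4 : (h * (2%:R * X ^+ 4 * s)) N.+1 = 0.
  by rewrite -mulrA (fcoefM_lead1 (f := h)) // fcoefMnat fcoefXnM /= !mulr0.
have /(congr1 (fun f : fps A => f N.+1)) := e.
do !rewrite ?fcoefD ?fcoefN ?fcoefMnat ?fcoefC.
(* The falling factorials of 1 of length 2, 3, 4 vanish, which leaves [N ^_ 4] - 4 [N ^_ 3]. *)
rewrite !L L4 (@ffact_small 1 4) // (@ffact_small 1 3) // (@ffact_small 1 2) // !ffactn0 ffactn1.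
rewrite !mulr0 !mulr1 !add0r addr0 subr0 => e2.
apply: (@SigmaExistence.intI A (N%:Z * (N%:Z - 1) * (N%:Z - 2%:Z) * (N%:Z - 7%:Z))).
  by move: N0; rewrite !inE !mulf_eq0; lia.
rewrite mulr0 -[RHS]e2.
have -> : (N ^_ 4)%:R = ((N ^_ 4)%:Z)%:~R :> A by [].
have -> : (N ^_ 3)%:R = ((N ^_ 3)%:Z)%:~R :> A by [].
rewrite mulrA -[4%:R]/(4%:Z%:~R) -intrM -mulrBl -intrB ffact43 //.
by move: N0; case: (N) => [|[|[|]]].
Qed.

Hypothesis s2 : s 2%N = 0.
Hypothesis s3 : s 3%N = 0.
Hypothesis bil1 : s * d (d (d (d s))) - 4%:R * d s * d (d (d s))
  + 3%:R * d (d s) ^+ 2 - x%:S * s ^+ 2 = 0.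
Hypothesis bil2 : d s * d (d (d (d (d s)))) - 4%:R * d (d s) * d (d (d (d s)))
  + 3%:R * d (d (d s)) ^+ 2 + x%:S * (d s) ^+ 2
  - 2%:R * x%:S * s * d (d s) + 3%:R * b%:S * s ^+ 2 = 0.

Variable D : {additive A -> A}.
Hypothesis DM : forall y z, D (y * z) = D y * z + y * D z.
Hypothesis Dx : D x = 6%:R * b.
Hypothesis Db : 6%:R * D b = 16%:R * x ^+ 2.

Let h := 6%:R * (d (d s) - fps_map D s) + x%:S * (X ^+ 2 * s).

(** With Q(s) the left side of [bil1], Q(s)'' = [bilin] (s'', s) + 2 Q(s'), and D Q(s) = [bilin] (D
    s, s) - 6 b s^2. By [bil2], Q(s') + 3 b s^2 = 2 x (s s'' - s'^2), while x u^2 s contributes 2 x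
    u^2 Q(s) + 24 x (s s'' - s'^2). Hence the coefficients 6, -12, -6 and 2 x u^2 below. *)
Let bilin_h : bilin h s = 0.
Proof.
have lc (c L1 L2 L3 L4 g : fps A) : L1 = 0 -> L2 = 0 -> L3 = 0 -> L4 = 0 ->
  g = 6%:R * L1 - 12%:R * L2 - 6%:R * L3 + c * L4 -> g = 0.
  by move=> -> -> -> -> ->; rewrite !mulr0 !subr0 addr0.
have E1 : d (d (s * d (d (d (d s))) - 4%:R * d s * d (d (d s))
  + 3%:R * (d (d s) * d (d s)) - x%:S * (s * s))) = 0.
  by rewrite -!expr2 bil1 !fderiv0.
have E3 : fps_map D (s * d (d (d (d s))) - 4%:R * d s * d (d (d s))
  + 3%:R * (d (d s) * d (d s)) - x%:S * (s * s)) = 0.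
  by rewrite -!expr2 bil1 fps_map0.
do !rewrite ?fderivD ?fderivN ?fderivM ?fderivC ?fderiv_nat ?fderiv0 ?(mul0r, add0r) in E1.
do !rewrite ?fps_mapD ?fps_mapN ?(fps_mapM DM) ?fps_mapC ?(fps_map_nat DM)
  ?fps_map_deriv
  ?(mul0r, add0r) in E3.
apply: (lc (2%:R * x%:S * X ^+ 2) _ _ _ _ _ E1 bil2 E3 bil1).
have -> : (D x)%:S = 6%:R * b%:S.
  by apply: fpsP => n; rewrite fcoefMnat Dx; case: n => //= n; rewrite mulr0.
rewrite /bilin /h expr2.
do !rewrite ?fderivD ?fderivN ?fderivM ?fderivC ?fderiv_nat ?fderivX ?fderiv0 ?fderiv1
  ?(mul0r, add0r).
ring.
Qed.

Local Notation S := (ecoef s).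

Let S0 : S 0%N = 0. Proof. by rewrite /ecoef s0 mulr0. Qed.
Let S1 : S 1%N = 1. Proof. by rewrite /ecoef s1 mulr1. Qed.
Let S2 : S 2%N = 0. Proof. by rewrite /ecoef s2 mulr0. Qed.
Let S3 : S 3%N = 0. Proof. by rewrite /ecoef s3 mulr0. Qed.

Lemma ecoef_bil1 n :
  \sum_(i < n.+1) 'C(n, i)%:R * (S i * S (n - i).+4)
  - 4%:R * \sum_(i < n.+1) 'C(n, i)%:R * (S i.+1 * S (n - i).+3)
  + 3%:R * \sum_(i < n.+1) 'C(n, i)%:R * (S i.+2 * S (n - i).+2)
  - x * \sum_(i < n.+1) 'C(n, i)%:R * (S i * S (n - i)%N) = 0.
Proof.
have /(congr1 (fun f => ecoef f n)) := bil1.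
rewrite {2}/ecoef mulr0 => e; rewrite -[RHS]e -mulrA !expr2.
rewrite !(ecoefD, ecoefN, ecoefCM, ecoefMnat) !ecoefM.
by congr (_ - _ * _ + _ * _ - _ * _); apply: eq_bigr => i _; rewrite !ecoef_deriv.
Qed.

Lemma ecoef_bil2 n :
  \sum_(i < n.+1) 'C(n, i)%:R * (S i.+1 * S (n - i).+1.+4)
  - 4%:R * \sum_(i < n.+1) 'C(n, i)%:R * (S i.+2 * S (n - i).+4)
  + 3%:R * \sum_(i < n.+1) 'C(n, i)%:R * (S i.+3 * S (n - i).+3)
  + x * \sum_(i < n.+1) 'C(n, i)%:R * (S i.+1 * S (n - i).+1)
  - 2%:R * (x * \sum_(i < n.+1) 'C(n, i)%:R * (S i * S (n - i).+2))
  + 3%:R * (b * \sum_(i < n.+1) 'C(n, i)%:R * (S i * S (n - i)%N)) = 0.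
Proof.
have /(congr1 (fun f => ecoef f n)) := bil2.
rewrite {2}/ecoef mulr0 => e; rewrite -[RHS]e -!mulrA !expr2.
rewrite !(ecoefD, ecoefN, ecoefCM, ecoefMnat) !ecoefM.
by congr (_ - _ * _ + _ * _ + _ * _ - _ * (_ * _) + _ * (_ * _));
  apply: eq_bigr => i _; rewrite !ecoef_deriv.
Qed.

Lemma ecoef5 : S 5%N = - x.
Proof.
have := ecoef_bil2 0; rewrite !big_ord1 !subn0 /= S0 S1 S2 S3 bin0 => e.
by apply: subr0_eq; rewrite -[RHS]e; ring.
Qed.

Hypothesis s_odd : forall n, ~~ odd n -> s n = 0.

Let S_odd n : ~~ odd n -> S n = 0.
Proof. by move=> on; rewrite /ecoef s_odd ?mulr0. Qed.

(** S_7 cancels from the first bilinear relation, 7 being a root of its indicial polynomial, so the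
    second one is needed. *)
Lemma ecoef7 : S 7%N = - (6%:R * b).
Proof.
have := ecoef_bil2 2; rewrite !big_ord_recl !big_ord0 /= /bump /= /subn /= ?add1n ?addn0.
rewrite S0 S1 S2 S3 (S_odd (n := 4)) // bin0 binn bin1 => e.
by apply: subr0_eq; rewrite -[RHS]e; ring.
Qed.

Lemma ecoef9 : S 9%N = - (9%:R * x ^+ 2).
Proof.
have := ecoef_bil1 6; rewrite !big_ord_recl !big_ord0 /= /bump /= /subn /= ?add1n ?addn0.
rewrite S0 S1 S2 S3 ecoef5 (S_odd (n := 4)) // (S_odd (n := 6)) // (S_odd (n := 8)) //.
rewrite (S_odd (n := 10)) // bin0 binn bin1 -[binomial 6 2]/15%N -[binomial 6 3]/20%N.
rewrite -[binomial 6 4]/15%N -[binomial 6 5]/6%N => e.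
(* S_9 occurs as 6 S_1 S_9 - 4 S_1 S_9, whence the factor 2. *)
apply: (@natr_lreg A 2) => //; apply: subr0_eq; rewrite -[RHS]e; ring.
Qed.

Let h_eq0 : h = 0.
Proof.
have hE n : h n = 6%:R * ((n.+1 * n.+2)%:R * s n.+2 - D (s n))
    + x * (if (2 <= n)%N then s (n - 2)%N else 0).
  rewrite /h; do !rewrite ?fcoefD ?fcoefN ?fcoefMnat ?fcoefC.
  by rewrite fcoefXnM /fderiv /fps_map mulrA natrM.
apply: bilin_kernel bilin_h _ _ _ _; rewrite hE.
- by rewrite s2 s0 raddf0 /= !mulr0 subr0 mulr0 addr0.
- by rewrite s3 s1 (leibniz1 DM) /= !mulr0 subr0 mulr0 addr0.
- by rewrite s2 s0 (s_odd (n := 4)) // raddf0 /= !mulr0 subr0 mulr0 addr0.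
(* Times 7!, the coefficient at u^7 is 6 (S_9 - D S_7) + 42 x S_5 = 6 (-9 + 16) x^2 - 42 x^2 = 0. *)
apply: (natr_lreg (fact_gt0 7)).
have D_natM k y : D (k%:R * y) = k%:R * D y by rewrite !mulr_natl raddfMn.
have e7 : 7`!%:R * D (s 7%N) = - (6%:R * D b).
  by rewrite -D_natM -/(ecoef s 7) ecoef7 raddfN D_natM.
have e9 := ecoef_shift2 s 7; rewrite ecoef9 in e9.
have e5 := fact2_fcoef s 5; rewrite ecoef5 in e5.
rewrite /= -[(7 - 2)%N]/5%N mulrDr (mulrCA _ 6%:R) (mulrCA _ x) mulrBr e7 e9 e5 Db; ring.
Qed.

(** The recursion at k = n + 2, kept multiplied by 6 because the division by 6 is the integrality
    question. *)
Lemma ecoef_heat n :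
  6%:R * (S n.+4 - D (S n.+2)) + (n.+2 * n.+1)%:R * x * S n = 0.
Proof.
have /(congr1 (fun f : fps A => ecoef f n.+2)) := h_eq0.
rewrite {2}/ecoef mulr0 => e; rewrite -[RHS]e /h ecoefD ecoefMnat ecoefD ecoefN !ecoef_deriv.
rewrite ecoefCM; congr (_ * (_ - _) + _).
  by rewrite /ecoef /fps_map !mulr_natl raddfMn.
by rewrite {2}/ecoef fcoefXnM /= subSS subSS subn0 fact2_fcoef; ring.
Qed.
End HeatEquation.

(** * Integrality of the recursion, by divisibility by 3 *)

Section Integrality.
Variables (A : comAlgType rat) (T : A -> Prop).
Hypothesis hT : is_subring T.

Lemma subring0 : T 0.
Proof. by case: hT => T1 TB _; rewrite -(subrr 1); apply: TB. Qed.

Lemma subringN y : T y -> T (- y).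
Proof. by case: hT => _ TB _ Ty; rewrite -sub0r; apply: TB => //; apply: subring0. Qed.

Lemma subringD y z : T y -> T z -> T (y + z).
Proof. by case: (hT) => _ TB _ Ty Tz; rewrite -(opprK z); apply/TB/subringN. Qed.

Lemma subringM y z : T y -> T z -> T (y * z).
Proof. by case: hT => _ _; apply. Qed.

Lemma subring_nat n : T n%:R.
Proof.
elim: n => [|n IH]; first exact: subring0.
by rewrite mulrS; apply: subringD => //; case: hT.
Qed.

Lemma subring_int (m : int) : T m%:~R.
Proof.
case: m => n; first exact: subring_nat.
by rewrite NegzE mulrNz; apply/subringN/subring_nat.
Qed.

Lemma subringX y n : T y -> T (y ^+ n).
Proof.
move=> Ty; elim: n => [|n IH]; first exact: (subring_nat 1).
by rewrite exprS; apply: subringM.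
Qed.

Lemma subring_adjoin2 (a b : A) : T a -> T b ->
  forall y, in_Zadjoin2 a b y -> T y.
Proof.
move=> Ta Tb y [P ->]; rewrite /mmap; apply: (big_ind T subring0 subringD) => m _.
apply: subringM; first exact: subring_int.
apply: (big_ind T (subring_nat 1) subringM) => i _; apply: subringX.
by case: ifP.
Qed.

(** Everything in A is divisible by 3, so the quotient is required to lie in T. *)
Definition mul3_of y := exists2 z, T z & y = 3%:R * z.

Lemma mul3_ofD y z : mul3_of y -> mul3_of z -> mul3_of (y + z).
Proof.
move=> [u Tu ->] [v Tv ->]; exists (u + v); first exact: subringD.
by rewrite mulrDr.
Qed.

Lemma mul3_ofM y z : mul3_of y -> T z -> mul3_of (y * z).
Proof.
move=> [u Tu ->] Tz; exists (u * z); first exact: subringM.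
by rewrite mulrA.
Qed.

Lemma mul3_ofMl y z : T y -> mul3_of z -> mul3_of (y * z).
Proof. by move=> Ty z3; rewrite mulrC; apply: mul3_ofM. Qed.

Lemma mul3_ofN y : mul3_of y -> mul3_of (- y).
Proof.
by move=> [u Tu ->]; exists (- u); [apply: subringN | rewrite mulrN].
Qed.

Lemma mul3_of0 : mul3_of 0.
Proof. by exists 0; rewrite ?mulr0 //; apply: subring0. Qed.

Lemma mul3_of_nat n : (3 %| n)%N -> mul3_of n%:R.
Proof.
by case/dvdnP => q ->; exists q%:R; [apply: subring_nat | rewrite natrM mulrC].
Qed.

(** In i C(n, i) = n C(n-1, i-1), 3 divides the right side and is prime to i. *)
Lemma dvd3_bin n i : (3 %| n)%N -> ~~ (3 %| i)%N -> (3 %| 'C(n, i))%N.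
Proof.
case: n i => [|n] [|i] // n3 i3; have := mul_bin_diag n.+1 i => /= e.
rewrite -(@Gauss_dvdr 3 i.+1) ?prime_coprime // -e.
exact: dvdn_mulr.
Qed.

Variables (x : A) (D : A -> A) (S : nat -> A).
Hypothesis Tx : T x.
Hypothesis TD : forall y, T y -> T (D y).
Hypothesis S0 : S 0%N = 0.
Hypothesis S1 : S 1%N = 1.
Hypothesis S2 : S 2%N = 0.
Hypothesis S3 : S 3%N = 0.
Hypothesis bil : forall n,
  \sum_(i < n.+1) 'C(n, i)%:R * (S i * S (n - i).+4)
  - 4%:R * \sum_(i < n.+1) 'C(n, i)%:R * (S i.+1 * S (n - i).+3)
  + 3%:R * \sum_(i < n.+1) 'C(n, i)%:R * (S i.+2 * S (n - i).+2)
  - x * \sum_(i < n.+1) 'C(n, i)%:R * (S i * S (n - i)%N) = 0.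
Hypothesis heat : forall n,
  6%:R * (S n.+4 - D (S n.+2)) + (n.+2 * n.+1)%:R * x * S n = 0.

Lemma heat_step n : T (S n) -> ((3 %| n)%N -> mul3_of (S n)) -> T (S n.+2) ->
  T (S n.+4).
Proof.
move=> Tn T3n Tn2.
have TE z : T z -> (n.+2 * n.+1)%:R * x * S n = 6%:R * z -> T (S n.+4).
  move=> Tz e; have := heat n; rewrite e -mulrDr => e2.
  have e3 : S n.+4 - D (S n.+2) + z = 0.
    by apply: (@natr_lreg A 6) => //; rewrite mulr0.
  have -> : S n.+4 = D (S n.+2) - z by apply: subr0_eq; rewrite -[RHS]e3; ring.
  by apply: subringD; [apply: TD | apply: subringN].
(* The factor 2 comes from consecutive integers; the factor 3 comes from S_n if 3 | n, and otherwise
   from n + 1 or n + 2. *)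
have [n3|n3] := boolP (3 %| n)%N.
  have [w Tw ew] := T3n n3.
  have /dvdnP [c ec] : (2 %| n.+2 * n.+1)%N by rewrite dvdn2 oddM /=; lia.
  apply: (TE (c%:R * x * w)); first by do 2!apply: subringM => //; apply: subring_nat.
  by rewrite ew ec natrM; ring.
have /dvdnP [c ec] : (6 %| n.+2 * n.+1)%N.
  rewrite (@Gauss_dvd 2 3) // dvdn2 oddM Euclid_dvdM //; lia.
apply: (TE (c%:R * x * S n)); first by do 2!apply: subringM => //; apply: subring_nat.
by rewrite ec natrM; ring.
Qed.

(* Modulo 3, for 3 | n, Lucas leaves only the terms 3 | i of the bilinear
   relation, and each of them except S_1 S_(n+3) has a factor S_k with 3 | k. *)
Lemma bilinear_step n : (3 %| n)%N -> (forall i, (i <= n.+3)%N -> T (S i)) ->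
  (forall i, (i <= n.+2)%N -> (3 %| i)%N -> mul3_of (S i)) -> mul3_of (S n.+3).
Proof.
move=> n3 TS T3S.
have sum3 m (F : 'I_m -> A) : (forall i, mul3_of (F i)) -> mul3_of (\sum_i F i).
  by move=> F3; apply: (big_ind mul3_of mul3_of0 mul3_ofD) => i _.
have bin3 i y : ~~ (3 %| i)%N -> T y -> mul3_of ('C(n, i)%:R * y).
  by move=> i3 Ty; apply: mul3_ofM => //; apply/mul3_of_nat/dvd3_bin.
have Tnat := subring_nat.
have h1 : mul3_of (\sum_(i < n.+1) 'C(n, i)%:R * (S i * S (n - i).+4)).
  (* The term i = 0 contains S_(n+4), about which nothing is assumed, but S_0 = 0. *)
  apply: sum3 => -[[|i] /= ilt]; first by rewrite S0 mul0r mulr0; apply: mul3_of0.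
  have Tn : T (S (n - i.+1).+4) by apply: TS; lia.
  have [i3|i3] := boolP (3 %| i.+1)%N; last first.
    by apply: bin3 => //; apply: subringM => //; apply: TS; lia.
  by apply: mul3_ofMl => //; apply: mul3_ofM => //; apply: T3S => //; lia.
have h4 : mul3_of (\sum_(i < n.+1) 'C(n, i)%:R * (S i * S (n - i)%N)).
  apply: sum3 => -[i /= ilt].
  have Tn : T (S (n - i)%N) by apply: TS; lia.
  have [i3|i3] := boolP (3 %| i)%N; last first.
    by apply: bin3 => //; apply: subringM => //; apply: TS; lia.
  by apply: mul3_ofMl => //; apply: mul3_ofM => //; apply: T3S => //; lia.
(* The second sum without its term S_1 S_(n+3). Here, when 3 | i+1, the factor divisible by 3 is the
   right one, of index n - (i+1) + 3. *)
have h2 : mul3_of (\sum_(i < n) 'C(n, i.+1)%:R * (S i.+2 * S (n - i.+1).+3)).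
  apply: sum3 => -[i /= ilt].
  have Tn : T (S i.+2) by apply: TS; lia.
  have [i3|i3] := boolP (3 %| i.+1)%N; last first.
    by apply: bin3 => //; apply: subringM => //; apply: TS; lia.
  apply: mul3_ofMl => //; apply: mul3_ofMl => //; apply: T3S; first lia.
  by rewrite -(addn3 (n - i.+1)) dvdn_addl ?dvdn_sub.
have h3 : mul3_of (3%:R * \sum_(i < n.+1) 'C(n, i)%:R * (S i.+2 * S (n - i).+2)).
  eexists; last by [].
  apply: (big_ind T subring0 subringD) => -[i /= ilt] _.
  by apply: subringM => //; apply: subringM; apply: TS; lia.
have := bil n; rewrite [X in _ - 4%:R * X + _]big_ord_recl /= bin0 S1 subn0 => e.
(* The relation controls 4 S_(n+3), and 4 is 1 modulo 3. *)
have -> : S n.+3 = 3%:R * - S n.+3 + 4%:R * S n.+3 by ring.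
apply: mul3_ofD; first by exists (- S n.+3) => //; apply/subringN/TS.
move: e; set a1 := \sum_(i < n.+1) _; set a2 := \sum_(i < n) _.
set a3 := \sum_(i < n.+1) _; set a4 := \sum_(i < n.+1) _ => e.
have -> : 4%:R * S n.+3 = a1 - 4%:R * a2 + 3%:R * a3 - x * a4.
  by apply: subr0_eq; rewrite -oppr0 -[in RHS]e; ring.
by apply: mul3_ofD; [apply: mul3_ofD => //; apply: mul3_ofD => //|];
  apply: mul3_ofN; apply: mul3_ofMl.
Qed.

(** Both claims go through one strong induction. At each n membership in T comes first, since the
    bilinear step for 3 | n presupposes it. *)
Lemma ecoef_integral n : T (S n).
Proof.
suff [] : T (S n) /\ ((3 %| n)%N -> mul3_of (S n)) by [].
elim/ltn_ind: n => n IH.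
have TS i : (i < n)%N -> T (S i) by move/IH => [].
have T3S i : (i < n)%N -> (3 %| i)%N -> mul3_of (S i) by move/IH => [].
have Tn : T (S n).
  case: n IH TS T3S => [|[|[|[|n]]]] IH TS T3S; rewrite ?S0 ?S1 ?S2 ?S3.
  - exact: subring0.
  - exact: (subring_nat 1).
  - exact: subring0.
  - exact: subring0.
  - by apply: heat_step; [apply: TS; lia | apply: T3S; lia | apply: TS; lia].
split=> //; case: n Tn {IH} TS T3S => [|[|[|n]]] // Tn TS T3S n3.
  by rewrite S0; apply: mul3_of0.
apply: bilinear_step => [|i|i ilt].
- by move: n3; rewrite -(addn3 n) dvdn_addl.
- by rewrite leq_eqVlt => /orP[/eqP -> //|]; apply: TS.
- exact: T3S.
Qed.
End Integrality.

(** * From Laurent series to identities between power series *)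

Section FromLaurentSeries.
Variable A : comAlgType rat.
Implicit Types f g : laurent A.
Local Notation X := (fpsX A).
Local Notation "c %:S" := (fps_const c) (at level 1, format "c %:S").
Local Notation d := (@fderiv A).

Lemma fcoef_lcoef f q n :
  (X ^+ q * (coefs f : fps A)) n = lcoef f (n%:Z - (pole f)%:Z - q%:Z).
Proof.
rewrite fcoefXnM /lcoef.
case e: (_ - _ + _) => [m|m]; last by rewrite ifF //; lia.
by rewrite ifT; [congr coefs; lia | lia].
Qed.

(** Laurent series are compared like fractions, by cross-multiplying with the powers of u in the
    denominators. *)
Lemma lcoef_eqP f g : lcoef f =1 lcoef g <->
  X ^+ pole g * (coefs f : fps A) = X ^+ pole f * (coefs g : fps A).
Proof.
split=> [e|e k].
  by apply: fpsP => n; rewrite !fcoef_lcoef e; congr lcoef; lia.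
case ek: (k + (pole f + pole g)%N%:Z) => [n|n].
  have := congr1 (fun f : fps A => f n) e; rewrite !fcoef_lcoef.
  have -> : n%:Z - (pole f)%:Z - (pole g)%:Z = k by lia.
  by have -> : n%:Z - (pole g)%:Z - (pole f)%:Z = k by lia.
rewrite /lcoef; case e1: (k + (pole f)%:Z) => [m|m]; first lia.
by case e2: (k + (pole g)%:Z) => [m2|m2]; first lia.
Qed.

Lemma eq_lmul f f' g g' : lcoef f =1 lcoef f' -> lcoef g =1 lcoef g' ->
  lcoef (lmul f g) =1 lcoef (lmul f' g').
Proof.
move=> /lcoef_eqP ef /lcoef_eqP eg; apply/lcoef_eqP => /=.
rewrite -[X in _ * X = _]/((coefs f : fps A) * (coefs g : fps A)).
rewrite -[X in _ = _ * X]/((coefs f' : fps A) * (coefs g' : fps A)).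
by rewrite !exprD mulrACA ef eg mulrACA.
Qed.

Lemma lcoef_lderiv f k : lcoef (lderiv f) k = (k + 1)%:~R * lcoef f (k + 1).
Proof.
rewrite /lcoef /=.
have -> : k + ((pole f).+1)%:Z = k + 1 + (pole f)%:Z by lia.
case e: (k + 1 + (pole f)%:Z) => [n|n]; last by rewrite mulr0.
by congr (_%:~R * _); lia.
Qed.

Lemma eq_lderiv f g : lcoef f =1 lcoef g -> lcoef (lderiv f) =1 lcoef (lderiv g).
Proof. by move=> e k; rewrite !lcoef_lderiv e. Qed.

(** Serves to replace the given representations of wp and zeta by ones with pole order exactly 2 and
    1. *)
Lemma lcoef_rep f p : (forall k, k < - p%:Z -> lcoef f k = 0) ->
  lcoef f =1 lcoef (Laurent p (fun n => lcoef f (n%:Z - p%:Z))).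
Proof.
move=> f0 k; rewrite [RHS]/lcoef /=.
by case e: (k + p%:Z) => [n|n]; [congr lcoef; lia | apply: f0; lia].
Qed.

Lemma sigma_fps (x b : A) (s : nat -> A) : is_weierstrass_sigma (2%:R * x) b s ->
  exists Z W V : fps A,
  [/\ X * d s = Z * s, X * d Z = Z - W, X * d W = V + 2%:R * W, V 0%N = - 2%:R
    & V ^+ 2 = 4%:R * W ^+ 3 - 2%:R * x%:S * X ^+ 4 * W - b%:S * X ^+ 6].
Proof.
case=> _ _ [wp [zeta [[wp2 wp0 wpE] zetaE dzetaE]]].
have wp_low k : k < - 2%:Z -> lcoef wp k = 0.
  by move=> k2; apply: wp0; [lia | apply/eqP; lia].
(* Since zeta' = - wp, k times the k-th coefficient of zeta is minus the coefficient of wp at k - 1,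
   which vanishes, and k is nonzero. *)
have zeta_low k : k < - 1%:Z -> lcoef zeta k = 0.
  move=> k1; have := dzetaE (k - 1); rewrite lcoef_lderiv subrK wp_low; last lia.
  move=> e; apply: (@SigmaExistence.intI A k); first by apply/eqP; lia.
  by rewrite mulr0; apply/eqP; rewrite -oppr_eq0 e.
have := lcoef_rep wp_low; have := lcoef_rep zeta_low.
set Z : fps A := fun n => lcoef zeta (n%:Z - 1%:Z).
set W : fps A := fun n => lcoef wp (n%:Z - 2%:Z) => zE wE.
(* wp' has coefficient (n - 2) W_n at u^(n-3), so this is u^3 wp'. *)
pose V : fps A := fun n => (n%:Z - 2%:Z)%:~R * W n.
have VE : X * d W = V + 2%:R * W.
  apply: fpsP => n; rewrite fcoef_Xderiv fcoefD fcoefMnat /V rmorphB /=; ring.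
exists Z, W, V; split=> //.
- apply: fpsP => n; rewrite fcoef_Xderiv; have := zetaE (n%:Z - 1%:Z).
  rewrite (eq_lmul zE (frefl _)) lcoef_lderiv /lcoef /= addn0 !subrK addr0 => e.
  by rewrite fcoefM e.
- apply: fpsP => n; rewrite fcoef_Xderiv fcoefD fcoefN.
  have := dzetaE (n%:Z - 2%:Z); rewrite lcoef_lderiv -/(W n) => <-.
  have -> : n%:Z - 2%:Z + 1 = n%:Z - 1%:Z by lia.
  rewrite -/(Z n) rmorphB /=; ring.
- by rewrite /V /W wp2 mulr1.
apply: fpsP => n; have := wpE (n%:Z - 6%:Z).
rewrite (eq_lmul (eq_lderiv wE) (eq_lderiv wE)).
rewrite (eq_lmul wE (eq_lmul wE wE)) wE.
have -> : V ^+ 2 = V * V by ring.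
have -> : 4%:R * W ^+ 3 - 2%:R * x%:S * X ^+ 4 * W - b%:S * X ^+ 6
  = 4%:R * (W * (W * W)) - (2%:R * (x%:S * (X ^+ 4 * W))) - b%:S * (X ^+ 6 * 1) by ring.
do !rewrite ?fcoefD ?fcoefN ?fcoefMnat ?fcoefC ?(fcoefXnM 4) ?(fcoefXnM 6).
rewrite /lcoef /= !addnS !addn0 subrK => e; apply: etrans e _.
congr (_ - _ - _).
  rewrite -mulrA; congr (_ * (_ * _)).
  case e: (n%:Z - 6%:Z + 2%:Z) => [m|m]; last by rewrite ifF //; lia.
  by rewrite ifT; [congr W; lia | lia].
have -> : (n%:Z - 6%:Z == 0) = (n == 6)%N by lia.
case: eqP => [->|n6]; first by rewrite mulr1.
case: ifP => n6'; last by rewrite mulr0.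
by rewrite -[(1 : fps A) (n - 6)%N]/(if (n - 6)%N == 0%N then 1 else 0) ifF ?mulr0 //; lia.
Qed.
End FromLaurentSeries.

(** * The heat operator on Q[g2, g3] *)

Lemma scale_half_natr (y : {mpoly rat[2]}) : 2%:R * ((2%:R^-1 : rat) *: y) = y.
Proof. by rewrite -scalerAr mulr_natl -scaler_nat scalerA mulVf // scale1r. Qed.

(* In terms of x = g2/2 and y = 6 g3 this is y d/dx + 16 x^2 d/dy. *)
Definition heat_op (p : {mpoly rat[2]}) : {mpoly rat[2]} :=
  12%:R * g3 * mderiv ord0 p + ((2%:R / 3%:R : rat) *: g2 ^+ 2) * mderiv ord_max p.

Fact heat_op_is_additive : additive heat_op.
Proof. by move=> p q; rewrite /heat_op !mderivB; ring. Qed.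

HB.instance Definition _ :=
  GRing.isZmodMorphism.Build {mpoly rat[2]} {mpoly rat[2]} heat_op heat_op_is_additive.

Lemma heat_opM p q : heat_op (p * q) = heat_op p * q + p * heat_op q.
Proof. by rewrite /heat_op !mderivM; ring. Qed.

Lemma mderiv_var (i j : 'I_2) : mderiv i ('X_j : {mpoly rat[2]}) = (i == j)%:R.
Proof.
rewrite mderivX mnmE eq_sym; case: eqP => [->|_]; last by rewrite scale0r.
rewrite scale1r -[in RHS]mpolyX0; congr mpolyX.
by apply/mnmP => k; rewrite mnmBE subnn mnmE.
Qed.

(** * Integrality and minimality over Q[g2, g3] *)

Unset Implicit Arguments.

Theorem corollary5p4 (sigma : nat -> {mpoly rat[2]})
  (hsigma : is_weierstrass_sigma g2 g3 sigma) :
  is_hurwitz (in_Zadjoin2 ((2%:R^-1 : rat) *: g2) (6%:R * g3)) sigma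
  /\ forall R : {mpoly rat[2]} -> Prop,
       is_subring R -> is_hurwitz R sigma ->
       forall x : {mpoly rat[2]},
         in_Zadjoin2 ((2%:R^-1 : rat) *: g2) (6%:R * g3) x -> R x.
Proof.
set x := _ *: g2; set T := in_Zadjoin2 x _.
have xE : 2%:R * x = g2 by apply: scale_half_natr.
have [s_low s_odd _] := hsigma.
have s0 : sigma 0%N = 0 by rewrite s_low.
have s1 : sigma 1%N = 1 by rewrite s_low.
have s2 : sigma 2%N = 0 by rewrite s_low.
have s3 : sigma 3%N = 0 by rewrite s_low.
have : is_weierstrass_sigma (2%:R * x) g3 sigma by rewrite xE.
case/sigma_fps => Z [W [V [eZ eW eV V0 V2]]].
have bil1 := sigma_bilinear1 eZ eW eV V0 V2.
have bil2 := sigma_bilinear2 eZ eW eV V0 V2.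
have Dg2 : heat_op g2 = 12%:R * g3.
  by rewrite /heat_op /g2 !mderiv_var /=; ring.
have Dg3 : heat_op g3 = (2%:R / 3%:R : rat) *: g2 ^+ 2.
  by rewrite /heat_op /g3 !mderiv_var /= mulr0 add0r mulr1.
have Dnat k y : heat_op (k%:R * y) = k%:R * heat_op y.
  by rewrite !mulr_natl raddfMn.
have Dx : heat_op x = 6%:R * g3.
  apply: (@natr_lreg {mpoly rat[2]} 2) => //.
  by rewrite -Dnat xE Dg2; ring.
have Db : 6%:R * heat_op g3 = 16%:R * x ^+ 2.
  rewrite Dg3 -xE mulr_natl -scaler_nat scalerA.
  have -> : 6%:R * (2%:R / 3%:R) = 4%:R :> rat by [].
  by rewrite scaler_nat -mulr_natl; ring.
have e5 := ecoef5 s0 s1 s2 s3 bil2.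
have e7 := ecoef7 s0 s1 s2 s3 bil2 s_odd.
have eE n : sigma n = (n`!%:R^-1 : rat) *: ecoef sigma n.
  rewrite /ecoef mulr_natl -scaler_nat scalerA mulVf ?scale1r //.
  by rewrite Num.Theory.pnatr_eq0 -lt0n fact_gt0.
split.
  have hT : is_subring T.
    split; first by exists 1; rewrite rmorph1.
      by move=> _ _ [P ->] [Q ->]; exists (P - Q); rewrite rmorphB.
    by move=> _ _ [P ->] [Q ->]; exists (P * Q); rewrite rmorphM.
  have Tx : T x by exists 'X_ord0; rewrite mmapX mmap1U.
  have Ty : T (6%:R * g3) by exists 'X_ord_max; rewrite mmapX mmap1U.
  have TD p : T p -> T (heat_op p).
    (* The q with both q and [heat_op q] in T form a subring; it contains both generators because D
       x = 6 g3 and D (6 g3) = 16 x^2. *)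
    suff Tsub : is_subring (fun q => T q /\ T (heat_op q)).
      move=> Tp; suff [] : T p /\ T (heat_op p) by [].
      apply: (subring_adjoin2 Tsub _ _ Tp); split=> //; first by rewrite Dx.
      rewrite Dnat Db; apply: (subringM hT); first exact: subring_nat.
      exact: subringX.
    have [T1 TB TM] := hT.
    split; first by rewrite (leibniz1 heat_opM); split=> //; apply: (subring0 hT).
      by move=> p1 q1 [? ?] [? ?]; rewrite raddfB; split; apply: TB.
    move=> p1 q1 [? ?] [? ?]; rewrite heat_opM; split; first exact: TM.
    by apply: (subringD hT); apply: TM.
  exists (ecoef sigma); split=> // n.
  have heat := ecoef_heat s0 s1 s2 s3 bil1 bil2 heat_opM Dx Db s_odd.
  apply: (ecoef_integral hT Tx TD _ _ _ _ (ecoef_bil1 bil1) heat);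
    by rewrite /ecoef ?s0 ?s1 ?s2 ?s3 ?mulr0 ?mulr1.
move=> R hR [c [Rc cE]] y.
(* Hurwitz coefficients are determined by the series, so c_n = S_n. *)
have {}Rc n : R (ecoef sigma n).
  rewrite /ecoef cE mulr_natl -scaler_nat scalerA mulfV ?scale1r //.
  by rewrite Num.Theory.pnatr_eq0 -lt0n fact_gt0.
apply: (subring_adjoin2 hR).
  by rewrite -[x]opprK -e5; apply: subringN.
by rewrite -[_ * g3]opprK -e7; apply: subringN.
Qed.
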